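(* Let $K$ be a field of characteristic zero, $n\geq1$, and let $A$ be a nonzero $K$-algebra. 1. The set $\mathcal{C}_{\mathbb{I}_n\otimes A}$ of regular elements of the algebra $\mathbb{I}_n\otimes A$ is neither a left nor a right Ore set. Therefore, the rings $Q_{l,\mathrm{cl}}(\mathbb{I}_n\otimes A)$ and $Q_{r,\mathrm{cl}}(\mathbb{I}_n\otimes A)$ do not exist. 2. The algebra $Q_l(\mathbb{I}_n\otimes A)$ contains infinite direct sums of nonzero left ideals, and so it is not a left Noetherian algebra. Similarly, the algebra $Q_r(\mathbb{I}_n\otimes A)$ contains infinite direct sums of nonzero right ideals, and so it is not a right Noetherian algebra.
   Context: Algebras are associative with $1$ and $\otimes=\otimes_K$. $\mathbb{I}_1$ is the algebra of polynomial integro-differential operators: the subalgebra of $\mathrm{End}_K(K[x])$ generated by (multiplication by) $x$, $\partial=\frac{d}{dx}$ and $\int:K[x]\to K[x]$, $x^m\mapsto\frac{x^{m+1}}{m+1}$ ($m\geq0$); $\mathbb{I}_n:=\mathbb{I}_1^{\otimes n}$. For a ring $R$, $\mathcal{C}_R$ is the set of regular elements (neither left nor right zero divisors). A multiplicative set $S$ of $R$ ($1\in S$, $SS\subseteq S$, $0\notin S$) is a left (right) Ore set if $Sr\cap Rs\neq\emptyset$ (respectively $rS\cap sR\neq\emptyset$) for all $r\in R$, $s\in S$. $Q_{l,\mathrm{cl}}(R):=\mathcal{C}_R^{-1}R$ and $Q_{r,\mathrm{cl}}(R):=R\,\mathcal{C}_R^{-1}$ are the classical left and right quotient rings, which exist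 exactly when $\mathcal{C}_R$ is a left (respectively right) Ore set. In any ring $R$, among the left (right) Ore sets contained in $\mathcal{C}_R$ there is a largest one, denoted $S_l(R)$ (respectively $S_r(R)$); $Q_l(R):=S_l(R)^{-1}R$ and $Q_r(R):=R\,S_r(R)^{-1}$ are the largest left and right quotient rings of $R$. *)

(* Defs.v *)
From HB Require Import structures.
From mathcomp Require Import all_boot all_algebra.
From mathcomp Require Import boolp classical_sets.

Set Implicit Arguments.
Unset Strict Implicit.
Unset Printing Implicit Defensive.

Import GRing.Theory.

Local Open Scope classical_set_scope.
Local Open Scope ring_scope.
Local Open Scope quotient_scope.

Section OreSets.
Variable R : pzRingType.
Implicit Types (S : set R) (r s : R).

Definition regular_elements : set R := [set r | GRing.lreg r /\ GRing.rreg r].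

Definition multiplicative_set S :=
  [/\ S 1, forall s t, S s -> S t -> S (s * t) & ~ S 0].

Definition left_ore_set S := multiplicative_set S /\
  forall r s, S s -> exists s' r', S s' /\ s' * r = r' * s.

Definition right_ore_set S := multiplicative_set S /\
  forall r s, S s -> exists s' r', S s' /\ r * s' = s * r'.

(* The union of all the left (right) Ore sets of regular elements; that it is
   itself one, hence the largest one, is [left_ore_max_largest]
   (resp. [right_ore_max_largest]) below. *)
Definition left_ore_max : set R := [set x | exists S,
  [/\ left_ore_set S, S `<=` regular_elements & S x]].

Definition right_ore_max : set R := [set x | exists S,
  [/\ right_ore_set S, S `<=` regular_elements & S x]].

Definition invertible r := exists u, u * r = 1 /\ r * u = 1.

Definition left_ideal (I : set R) :=
  [/\ I 0, forall x y, I x -> I y -> I (x + y) & forall r x, I x -> I (r * x)].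

Definition right_ideal (I : set R) :=
  [/\ I 0, forall x y, I x -> I y -> I (x + y) & forall r x, I x -> I (x * r)].

Definition nonzero_set (I : set R) := exists2 x, I x & x <> 0.

(* the sum of the additive subgroups [I k] is direct *)
Definition independent (I : nat -> set R) :=
  forall m (x : 'I_m -> R), (forall k : 'I_m, I k (x k)) ->
    \sum_(k < m) x k = 0 -> forall k, x k = 0.

Definition has_infinite_direct_sum_of_left_ideals :=
  exists I : nat -> set R, [/\ forall k, left_ideal (I k),
    forall k, nonzero_set (I k) & independent I].

Definition has_infinite_direct_sum_of_right_ideals :=
  exists I : nat -> set R, [/\ forall k, right_ideal (I k),
    forall k, nonzero_set (I k) & independent I].

Definition left_noetherian := forall I : nat -> set R,
  (forall k, left_ideal (I k)) -> (forall k, I k `<=` I k.+1) ->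
  exists k, forall m, (k <= m)%N -> I m = I k.

Definition right_noetherian := forall I : nat -> set R,
  (forall k, right_ideal (I k)) -> (forall k, I k `<=` I k.+1) ->
  exists k, forall m, (k <= m)%N -> I m = I k.

End OreSets.

Arguments regular_elements : clear implicits.
Arguments left_ore_max : clear implicits.
Arguments right_ore_max : clear implicits.

(* [i : R -> Q] exhibits [Q] as S^-1 R: the elements of [S] become invertible,
   every element of [Q] has the form (i s)^-1 * i r, and the kernel of [i] is
   the S-torsion of [R]. *)
Definition is_left_quotient_ring (R Q : pzRingType) (S : set R)
    (i : {rmorphism R -> Q}) :=
  [/\ forall s, S s -> invertible (i s),
      forall q, exists s r, S s /\ i s * q = i r
    & forall r, i r = 0 <-> exists2 s, S s & s * r = 0].

Definition is_right_quotient_ring (R Q : pzRingType) (S : set R)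
    (i : {rmorphism R -> Q}) :=
  [/\ forall s, S s -> invertible (i s),
      forall q, exists s r, S s /\ q * i s = i r
    & forall r, i r = 0 <-> exists2 s, S s & r * s = 0].

Section GeneratedSubalgebra.
Variables (K : pzRingType) (E : algType K) (G : set E).

Definition gen_subalg : {pred E} := fun f => `[< forall P : {pred E},
  GRing.subalg_closed P -> (forall g, G g -> g \in P) -> f \in P >].

Lemma gen_subalg_closed : GRing.subalg_closed gen_subalg.
Proof.
split=> [|a u v|u v].
- by apply/asboolP => P [P1 _ _] _.
- move=> /asboolP Pu /asboolP Pv; apply/asboolP => P hP GP; have [_ PL PM] := hP.
  by apply: PL; [exact: Pu | exact: Pv].
- move=> /asboolP Pu /asboolP Pv; apply/asboolP => P hP GP; have [_ PL PM] := hP.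
  by apply: PM; [exact: Pu | exact: Pv].
Qed.

HB.instance Definition _ := GRing.isSubalgClosed.Build K E gen_subalg
  (GRing.subalg_closed_semi gen_subalg_closed).

Lemma mem_gen_subalg g : G g -> g \in gen_subalg.
Proof. by move=> Gg; apply/asboolP => P _; apply. Qed.

End GeneratedSubalgebra.

Section PolyEnd.
Variable K : fieldType.

Definition polyEnd := {linear {poly K} -> {poly K}}.

Definition mk_polyEnd (f : {poly K} -> {poly K}) (f_lin : linear f) : polyEnd :=
  HB.pack f (GRing.isLinear.Build K {poly K} {poly K} _ f f_lin).

Implicit Types f g h : polyEnd.

HB.instance Definition _ := gen_eqMixin polyEnd.
HB.instance Definition _ := gen_choiceMixin polyEnd.

Lemma polyEndP f g : f =1 g -> f = g.
Proof.
case: f => f [[f1] [f2]]; case: g => g [[g1] [g2]] /= /funext fg.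
by subst g; rewrite (Prop_irrelevance f1 g1) (Prop_irrelevance f2 g2).
Qed.

Fact polyEnd_add_subproof f g : linear (fun p => f p + g p).
Proof. by move=> a u v; rewrite !linearP scalerDr addrACA. Qed.
Definition polyEnd_add f g : polyEnd := mk_polyEnd (polyEnd_add_subproof f g).

Fact polyEnd_scale_subproof a f : linear (fun p => a *: f p).
Proof. by move=> b u v; rewrite linearP scalerDr !scalerA mulrC. Qed.
Definition polyEnd_scale a f : polyEnd := mk_polyEnd (polyEnd_scale_subproof a f).

Fact polyEnd_zero_subproof : linear (fun _ : {poly K} => 0 : {poly K}).
Proof. by move=> b u v; rewrite scaler0 addr0. Qed.
Definition polyEnd_zero : polyEnd := mk_polyEnd polyEnd_zero_subproof.

Definition polyEnd_one : polyEnd := idfun.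
Definition polyEnd_mul f g : polyEnd := f \o g.

Fact polyEnd_addA : associative polyEnd_add.
Proof. by move=> f g h; apply/polyEndP => p /=; rewrite addrA. Qed.
Fact polyEnd_addC : commutative polyEnd_add.
Proof. by move=> f g; apply/polyEndP => p /=; rewrite addrC. Qed.
Fact polyEnd_add0 : left_id polyEnd_zero polyEnd_add.
Proof. by move=> f; apply/polyEndP => p /=; rewrite add0r. Qed.
Fact polyEnd_addN : left_inverse polyEnd_zero (polyEnd_scale (-1)) polyEnd_add.
Proof. by move=> f; apply/polyEndP => p /=; rewrite scaleN1r addNr. Qed.
HB.instance Definition _ := GRing.isZmodule.Build polyEnd
  polyEnd_addA polyEnd_addC polyEnd_add0 polyEnd_addN.

Fact polyEnd_mulA : associative polyEnd_mul.
Proof. by move=> f g h; apply/polyEndP. Qed.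
Fact polyEnd_mul1l : left_id polyEnd_one polyEnd_mul.
Proof. by move=> f; apply/polyEndP. Qed.
Fact polyEnd_mul1r : right_id polyEnd_one polyEnd_mul.
Proof. by move=> f; apply/polyEndP. Qed.
Fact polyEnd_mulDl : left_distributive polyEnd_mul +%R.
Proof. by move=> f g h; apply/polyEndP. Qed.
Fact polyEnd_mulDr : right_distributive polyEnd_mul +%R.
Proof. by move=> f g h; apply/polyEndP => p /=; rewrite linearD. Qed.
Fact polyEnd_one_neq0 : polyEnd_one != 0.
Proof.
apply/eqP => e; have := congr1 (fun f : polyEnd => f 1) e.
by move=> /= /eqP; rewrite oner_eq0.
Qed.
HB.instance Definition _ := GRing.Zmodule_isNzRing.Build polyEnd
  polyEnd_mulA polyEnd_mul1l polyEnd_mul1r polyEnd_mulDl polyEnd_mulDr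
  polyEnd_one_neq0.

Fact polyEnd_scaleA a b f :
  polyEnd_scale a (polyEnd_scale b f) = polyEnd_scale (a * b) f.
Proof. by apply/polyEndP => p /=; rewrite scalerA. Qed.
Fact polyEnd_scale1 : left_id 1 polyEnd_scale.
Proof. by move=> f; apply/polyEndP => p /=; rewrite scale1r. Qed.
Fact polyEnd_scaleDr : right_distributive polyEnd_scale +%R.
Proof. by move=> a f g; apply/polyEndP => p /=; rewrite scalerDr. Qed.
Fact polyEnd_scaleDl f : {morph polyEnd_scale^~ f : a b / a + b}.
Proof. by move=> a b; apply/polyEndP => p /=; rewrite scalerDl. Qed.
HB.instance Definition _ := GRing.Zmodule_isLmodule.Build K polyEnd
  polyEnd_scaleA polyEnd_scale1 polyEnd_scaleDr polyEnd_scaleDl.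

Fact polyEnd_scaleAl (a : K) (f g : polyEnd) : a *: (f * g) = (a *: f) * g.
Proof. by apply/polyEndP. Qed.
HB.instance Definition _ := GRing.Lmodule_isLalgebra.Build K polyEnd
  polyEnd_scaleAl.
Fact polyEnd_scaleAr (a : K) (f g : polyEnd) : a *: (f * g) = f * (a *: g).
Proof. by apply/polyEndP => p /=; rewrite linearZ. Qed.
HB.instance Definition _ := GRing.Lalgebra_isAlgebra.Build K polyEnd
  polyEnd_scaleAr.

Lemma polyEnd_addE f g p : (f + g) p = f p + g p. Proof. by []. Qed.
Lemma polyEnd_mulE f g p : (f * g) p = f (g p). Proof. by []. Qed.
Lemma polyEnd_scaleE a f p : (a *: f) p = a *: f p. Proof. by []. Qed.

Fact mulX_subproof : linear (fun p : {poly K} => 'X * p).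
Proof. by move=> a u v; rewrite mulrDr scalerAr. Qed.
Definition op_x : polyEnd := mk_polyEnd mulX_subproof.

Definition op_d : polyEnd := @deriv K.

Definition poly_int (p : {poly K}) : {poly K} :=
  \sum_(i < size p) (p`_i / i.+1%:R) *: 'X^(i.+1).

Lemma coef_poly_int p j :
  (poly_int p)`_j = if j is i.+1 then p`_i / i.+1%:R else 0.
Proof.
rewrite coef_sum; case: j => [|i].
  by apply: big1 => k _; rewrite coefZ coefXn mulr0.
under eq_bigr do rewrite coefZ coefXn eqSS.
have [lip|lpi] := ltnP i (size p); last first.
  rewrite nth_default // mul0r; apply: big1 => k _.
  by rewrite gtn_eqF ?mulr0 //; apply: leq_trans lpi.
rewrite (bigD1 (Ordinal lip)) //= eqxx mulr1 big1 ?addr0 // => k nk.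
by rewrite (_ : (i == k :> nat) = false) ?mulr0 // eq_sym; apply: negPf.
Qed.

Fact poly_int_subproof : linear poly_int.
Proof.
move=> a u v; apply/polyP => -[|j]; rewrite coefD coefZ !coef_poly_int.
  by rewrite mulr0 addr0.
by rewrite coefD coefZ mulrDl mulrA.
Qed.
Definition op_int : polyEnd := mk_polyEnd poly_int_subproof.

Lemma op_intXn m : op_int 'X^m = m.+1%:R^-1 *: 'X^(m.+1).
Proof.
apply/polyP => -[|j]; rewrite coef_poly_int coefZ !coefXn ?mulr0 // eqSS.
by case: eqP => [->|_]; rewrite ?mul0r ?mulr0 // mul1r mulr1.
Qed.

Definition I1_generators : set polyEnd :=
  [set f | [\/ f = op_x, f = op_d | f = op_int]].

Record I1 := MkI1 { I1_val :> polyEnd ; _ : I1_val \in gen_subalg I1_generators }.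

HB.instance Definition _ := [isSub for I1_val].
HB.instance Definition _ := [Choice of I1 by <:].
HB.instance Definition _ := [SubChoice_isSubAlgebra of I1 by <:].

End PolyEnd.

Section Tensor.
Variables (K : fieldType) (A B : algType K).
Implicit Types (s t : seq (A * B)).

Definition bilinear_map (V : lmodType K) (f : A -> B -> V) :=
  (forall b, linear (f^~ b)) /\ (forall a, linear (f a)).

Definition tens_sum (V : lmodType K) (f : A -> B -> V) s : V :=
  \sum_(p <- s) f p.1 p.2.

(* The list [:: (a_1, b_1); ...; (a_m, b_m)] stands for the tensor
   a_1 (x) b_1 + ... + a_m (x) b_m; two lists give the same tensor iff no
   bilinear map distinguishes them. *)
Definition tens_eqv s t := `[< forall (V : lmodType K) (f : A -> B -> V),
  bilinear_map f -> tens_sum f s = tens_sum f t >].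

Fact tens_eqv_refl : reflexive tens_eqv.
Proof. by move=> s; apply/asboolP. Qed.
Fact tens_eqv_sym : symmetric tens_eqv.
Proof. by move=> s t; apply/asboolP/asboolP => e V f bf; rewrite e. Qed.
Fact tens_eqv_trans : transitive tens_eqv.
Proof.
by move=> t s u /asboolP e1 /asboolP e2; apply/asboolP => V f bf; rewrite e1 ?e2.
Qed.

Canonical tens_equiv := EquivRel tens_eqv tens_eqv_refl tens_eqv_sym tens_eqv_trans.

Definition tens := {eq_quot tens_equiv}.
HB.instance Definition _ := Choice.on tens.

Definition tens_of s : tens := \pi_tens s.

Lemma tens_ofP s t :
  (forall (V : lmodType K) (f : A -> B -> V), bilinear_map f ->
     tens_sum f s = tens_sum f t) <-> tens_of s = tens_of t.
Proof.
split=> [e|/eqP]; first by apply/eqP; rewrite /tens_of eqmodE; apply/asboolP.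
by rewrite /tens_of eqmodE => /asboolP.
Qed.

Lemma tens_surj (x : tens) : exists s, x = tens_of s.
Proof. by exists (repr x); rewrite /tens_of reprK. Qed.

Lemma tens_sum_repr (V : lmodType K) (f : A -> B -> V) s : bilinear_map f ->
  tens_sum f (repr (tens_of s)) = tens_sum f s.
Proof. by move=> bf; apply/(tens_ofP _ s).2 => //; rewrite /tens_of reprK. Qed.

Lemma tens_sum_cat (V : lmodType K) (f : A -> B -> V) s t :
  tens_sum f (s ++ t) = tens_sum f s + tens_sum f t.
Proof. exact: big_cat. Qed.

Definition scales (c : K) s := [seq (c *: p.1, p.2) | p <- s].
Definition muls s t := [seq (p.1 * q.1, p.2 * q.2) | p <- s, q <- t].

Lemma tens_sum_scales (V : lmodType K) (f : A -> B -> V) c s : bilinear_map f ->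
  tens_sum f (scales c s) = c *: tens_sum f s.
Proof.
case=> fl _; rewrite /tens_sum big_map scaler_sumr; apply: eq_bigr => p _ /=.
by have /= := scalable_linear (fl p.2) c p.1.
Qed.

Lemma tens_sum_muls (V : lmodType K) (f : A -> B -> V) s t : tens_sum f (muls s t) =
  \sum_(p <- s) \sum_(q <- t) f (p.1 * q.1) (p.2 * q.2).
Proof. by rewrite /tens_sum big_allpairs_dep. Qed.

Lemma bilinear_mulr (V : lmodType K) (f : A -> B -> V) t : bilinear_map f ->
  bilinear_map (fun a b => \sum_(q <- t) f (a * q.1) (b * q.2)).
Proof.
case=> fl fr; split=> [b|a] c u v; rewrite scaler_sumr -big_split;
  apply: eq_bigr => q _ /=; rewrite mulrDl -scalerAl; [exact: fl | exact: fr].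
Qed.

Lemma bilinear_mull (V : lmodType K) (f : A -> B -> V) s : bilinear_map f ->
  bilinear_map (fun a b => \sum_(p <- s) f (p.1 * a) (p.2 * b)).
Proof.
case=> fl fr; split=> [b|a] c u v; rewrite scaler_sumr -big_split;
  apply: eq_bigr => q _ /=; rewrite mulrDr -scalerAr; [exact: fl | exact: fr].
Qed.

Definition tens_zero : tens := tens_of [::].
Definition tens_add (x y : tens) : tens := tens_of (repr x ++ repr y).
Definition tens_scale (c : K) (x : tens) : tens := tens_of (scales c (repr x)).
Definition tens_one : tens := tens_of [:: (1, 1)].
Definition tens_mul (x y : tens) : tens := tens_of (muls (repr x) (repr y)).

Lemma tens_add_of s t : tens_add (tens_of s) (tens_of t) = tens_of (s ++ t).
Proof.
by apply/tens_ofP => V f bf; rewrite !tens_sum_cat !tens_sum_repr.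
Qed.

Lemma tens_scale_of c s : tens_scale c (tens_of s) = tens_of (scales c s).
Proof.
by apply/tens_ofP => V f bf; rewrite !tens_sum_scales ?tens_sum_repr.
Qed.

Lemma tens_mul_of s t : tens_mul (tens_of s) (tens_of t) = tens_of (muls s t).
Proof.
apply/tens_ofP => V f bf; rewrite !tens_sum_muls.
have /= e1 := tens_sum_repr s (bilinear_mulr (repr (tens_of t)) bf).
rewrite /tens_sum in e1; rewrite {}e1 exchange_big [RHS]exchange_big /=.
exact: (tens_sum_repr t (bilinear_mull s bf)).
Qed.

Fact tens_addA : associative tens_add.
Proof.
move=> x y z; have [s ->] := tens_surj x; have [t ->] := tens_surj y.
by have [u ->] := tens_surj z; rewrite !tens_add_of catA.
Qed.
Fact tens_addC : commutative tens_add.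
Proof.
move=> x y; have [s ->] := tens_surj x; have [t ->] := tens_surj y.
by rewrite !tens_add_of; apply/tens_ofP => V f bf; rewrite !tens_sum_cat addrC.
Qed.
Fact tens_add0 : left_id tens_zero tens_add.
Proof. by move=> x; have [s ->] := tens_surj x; rewrite tens_add_of. Qed.
Fact tens_addN : left_inverse tens_zero (tens_scale (-1)) tens_add.
Proof.
move=> x; have [s ->] := tens_surj x; rewrite tens_scale_of tens_add_of.
apply/tens_ofP => V f bf; rewrite tens_sum_cat tens_sum_scales // scaleN1r addNr.
by rewrite /tens_sum big_nil.
Qed.
HB.instance Definition _ := GRing.isZmodule.Build tens
  tens_addA tens_addC tens_add0 tens_addN.

Lemma tens_ofD s t : tens_of s + tens_of t = tens_of (s ++ t).
Proof. exact: tens_add_of. Qed.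

Fact tens_mulA : associative tens_mul.
Proof.
move=> x y z; have [s ->] := tens_surj x; have [t ->] := tens_surj y.
have [u ->] := tens_surj z; rewrite !tens_mul_of; apply/tens_ofP => V f bf.
rewrite /tens_sum !big_allpairs_dep; apply: eq_bigr => p _; rewrite !big_allpairs_dep.
by apply: eq_bigr => q _; apply: eq_bigr => r _ /=; rewrite !mulrA.
Qed.
Fact tens_mul1l : left_id tens_one tens_mul.
Proof.
move=> x; have [s ->] := tens_surj x; rewrite tens_mul_of.
apply/tens_ofP => V f bf; rewrite tens_sum_muls big_seq1.
by apply: eq_bigr => q _; rewrite !mul1r.
Qed.
Fact tens_mul1r : right_id tens_one tens_mul.
Proof.
move=> x; have [s ->] := tens_surj x; rewrite tens_mul_of.
apply/tens_ofP => V f bf; rewrite tens_sum_muls.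
by apply: eq_bigr => q _; rewrite big_seq1 !mulr1.
Qed.
Fact tens_mulDl : left_distributive tens_mul +%R.
Proof.
move=> x y z; have [s ->] := tens_surj x; have [t ->] := tens_surj y.
have [u ->] := tens_surj z; rewrite tens_ofD !tens_mul_of tens_ofD.
apply/tens_ofP => V f bf; rewrite tens_sum_cat !tens_sum_muls.
exact: big_cat.
Qed.
Fact tens_mulDr : right_distributive tens_mul +%R.
Proof.
move=> x y z; have [s ->] := tens_surj x; have [t ->] := tens_surj y.
have [u ->] := tens_surj z; rewrite tens_ofD !tens_mul_of tens_ofD.
apply/tens_ofP => V f bf; rewrite tens_sum_cat !tens_sum_muls -big_split.
by apply: eq_bigr => p _; exact: big_cat.
Qed.

End Tensor.

Lemma exists_functional (K : fieldType) (V : lmodType K) (v0 : V) : v0 != 0 ->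
  exists f : V -> K^o, linear f /\ f v0 = 1.
Proof.
move=> v0n0.
pose P (W : set V) := (forall c u v, W u -> W v -> W (c *: u + v)) /\ ~ W v0.
have [F FP totF|W [[Wlin Wv0] Wmax]] := @Zorn_bigcup V P.
  split=> [c u v [X FX Xu] [Y FY Yv]|[X FX]]; last by have [_] := FP X FX.
  have [XY|YX] := totF X Y FX FY.
    by exists Y => //; apply: (FP Y FY).1 => //; apply: XY.
  by exists X => //; apply: (FP X FX).1 => //; apply: YX.
have W0 : W 0.
  apply: contrapT => nW0; apply: (Wmax [set 0]).
    split=> [w Ww|/(_ 0 erefl)] //; case: nW0.
    by rewrite -(addNr w) -scaleN1r; apply: Wlin.
  split=> [c u v -> ->|/= e]; first by rewrite /= scaler0 addr0.
  by move: v0n0; rewrite e eqxx.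
have WZ c u : W u -> W (c *: u) by move=> Wu; rewrite -[_ *: _]addr0; apply: Wlin.
have WD u v : W u -> W v -> W (u + v).
  by move=> Wu Wv; rewrite -[u]scale1r; apply: Wlin.
have ex v : exists c, W (v - c *: v0).
  have [Wv|nWv] := pselect (W v); first by exists 0; rewrite scale0r subr0.
  pose B := [set x | exists a w, W w /\ x = a *: v + w].
  have [a [w [Ww e]]] : B v0.
    apply: contrapT => nB; apply: (Wmax B); last first.
      split=> // c _ _ [a [w [Ww ->]]] [b [x [Wx ->]]].
      exists (c * a + b), (c *: w + x); split; first exact: Wlin.
      by rewrite scalerDr scalerDl scalerA addrACA.
    split=> [w Ww|/(_ v)]; first by exists 0, w; rewrite scale0r add0r.
    by move=> BW; apply: nWv; apply: BW; exists 1, 0; rewrite scale1r addr0.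
  have an0 : a != 0.
    by apply: contra_notN Wv0 => /eqP a0; rewrite e a0 scale0r add0r.
  exists a^-1; rewrite e scalerDr scalerA mulVf // scale1r opprD addrA subrr add0r.
  by rewrite -scalerN; apply: (WZ); rewrite -scaleN1r; apply: WZ.
have uniq v c c' : W (v - c *: v0) -> W (v - c' *: v0) -> c = c'.
  move=> Wc Wc'; apply/eqP; rewrite -subr_eq0; apply: contra_notT Wv0 => nz.
  have : W ((c - c')^-1 *: ((-1) *: (v - c *: v0) + (v - c' *: v0))).
    by apply: WZ; apply: Wlin.
  rewrite scaleN1r opprB addrA subrK -scalerBl scalerA mulVf //.
  by rewrite scale1r.
pose f v : K^o := sval (cid (ex v)).
have fP v : W (v - f v *: v0) by rewrite /f; case: cid.
exists f; split=> [c u v|]; last first.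
  by apply: (uniq v0) => //; rewrite scale1r subrr.
apply: (uniq (c *: u + v)) => //.
rewrite scalerDl -scalerA opprD addrACA -scalerBr.
by apply: Wlin.
Qed.

Section TensorAlgebra.
Variables (K : fieldType) (A B : algType K).

Fact tens_one_neq0 : tens_one A B != 0.
Proof.
have [f [fl f1]] := exists_functional (oner_neq0 A).
have [g [gl g1]] := exists_functional (oner_neq0 B).
apply/eqP => /tens_ofP /(_ K^o (fun a b => f a * g b)) e.
suff: f 1 * g 1 = 0 by rewrite f1 g1 mulr1 => /eqP; rewrite oner_eq0.
move: e; rewrite /tens_sum big_seq1 big_nil; apply.
split=> [b|a] c u v; first by rewrite fl mulrDl -scalerAl.
by rewrite gl mulrDr -scalerAr.
Qed.

HB.instance Definition _ := GRing.Zmodule_isNzRing.Build (tens A B)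
  (@tens_mulA K A B) (@tens_mul1l K A B) (@tens_mul1r K A B)
  (@tens_mulDl K A B) (@tens_mulDr K A B) tens_one_neq0.

Fact tens_scaleA a b (x : tens A B) :
  tens_scale a (tens_scale b x) = tens_scale (a * b) x.
Proof.
have [s ->] := tens_surj x; rewrite !tens_scale_of; congr tens_of.
by rewrite /scales -map_comp; apply: eq_map => p /=; rewrite scalerA.
Qed.
Fact tens_scale1 : left_id 1 (@tens_scale K A B).
Proof.
move=> x; have [s ->] := tens_surj x; rewrite !tens_scale_of; congr tens_of.
by rewrite /scales -[RHS]map_id; apply: eq_map => -[a b] /=; rewrite scale1r.
Qed.
Fact tens_scaleDr : right_distributive (@tens_scale K A B) +%R.
Proof.
move=> c x y; have [s ->] := tens_surj x; have [t ->] := tens_surj y.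
by rewrite tens_ofD !tens_scale_of tens_ofD /scales map_cat.
Qed.
Fact tens_scaleDl x : {morph (@tens_scale K A B)^~ x : a b / a + b}.
Proof.
move=> c d; have [s ->] := tens_surj x; rewrite !tens_scale_of tens_ofD.
by apply/tens_ofP => V f bf; rewrite tens_sum_cat !tens_sum_scales // scalerDl.
Qed.
HB.instance Definition _ := GRing.Zmodule_isLmodule.Build K (tens A B)
  tens_scaleA tens_scale1 tens_scaleDr tens_scaleDl.

Lemma tens_ofZ c (s : seq (A * B)) : c *: tens_of s = tens_of (scales c s).
Proof. exact: tens_scale_of. Qed.

Lemma tens_ofM (s t : seq (A * B)) : tens_of s * tens_of t = tens_of (muls s t).
Proof. exact: tens_mul_of. Qed.

Fact tens_scaleAl (c : K) (x y : tens A B) : c *: (x * y) = (c *: x) * y.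
Proof.
have [s ->] := tens_surj x; have [t ->] := tens_surj y.
rewrite tens_ofM !tens_ofZ tens_ofM; apply/tens_ofP => V f bf.
rewrite tens_sum_scales // !tens_sum_muls scaler_sumr big_map.
apply: eq_bigr => p _; rewrite scaler_sumr; apply: eq_bigr => q _ /=.
by rewrite -scalerAl -(scalable_linear (bf.1 _)).
Qed.
HB.instance Definition _ := GRing.Lmodule_isLalgebra.Build K (tens A B)
  tens_scaleAl.

Fact tens_scaleAr (c : K) (x y : tens A B) : c *: (x * y) = x * (c *: y).
Proof.
have [s ->] := tens_surj x; have [t ->] := tens_surj y.
rewrite tens_ofM !tens_ofZ tens_ofM; apply/tens_ofP => V f bf.
rewrite tens_sum_scales // !tens_sum_muls scaler_sumr.
apply: eq_bigr => p _; rewrite scaler_sumr big_map; apply: eq_bigr => q _ /=.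
by rewrite -scalerAr -(scalable_linear (bf.1 _)).
Qed.
HB.instance Definition _ := GRing.Lalgebra_isAlgebra.Build K (tens A B)
  tens_scaleAr.

Definition pure (a : A) (b : B) : tens A B := tens_of [:: (a, b)].

Lemma pure_bilinear : bilinear_map pure.
Proof.
split=> [b|a] c u v; rewrite /pure tens_ofZ tens_ofD; apply/tens_ofP => V f bf;
  rewrite tens_sum_cat tens_sum_scales // /tens_sum !big_seq1 /=.
  exact: (bf.1 b c u v).
exact: (bf.2 a c u v).
Qed.

Lemma pure1 : pure 1 1 = 1. Proof. by []. Qed.

Lemma pureM a a' b b' : pure a b * pure a' b' = pure (a * a') (b * b').
Proof. by rewrite /pure tens_ofM. Qed.

Lemma tens_ofE s : tens_of s = \sum_(p <- s) pure p.1 p.2.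
Proof.
elim: s => [|[a b] s IH]; rewrite ?big_nil ?big_cons //= -IH.
by rewrite /pure tens_ofD.
Qed.

Lemma tens_universal (V : lmodType K) (f : A -> B -> V) : bilinear_map f ->
  exists! g : {linear tens A B -> V}, forall a b, g (pure a b) = f a b.
Proof.
move=> bf; pose g (x : tens A B) : V := tens_sum f (repr x).
have glin : linear g.
  move=> c x y; have [s ->] := tens_surj x; have [t ->] := tens_surj y.
  rewrite /g tens_ofZ tens_ofD !tens_sum_repr // tens_sum_cat.
  by rewrite tens_sum_scales.
pose gl := GRing.isLinear.Build K (tens A B) V _ g glin.
pose G : {linear tens A B -> V} := HB.pack g gl.
exists G; split=> [a b|h hP].
  by rewrite /= /g /pure tens_sum_repr // /tens_sum big_seq1.
have gh : g =1 h.
  move=> x; have [s ->] := tens_surj x; rewrite /g tens_sum_repr // tens_ofE.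
  by rewrite linear_sum; apply: eq_bigr => p _; rewrite hP.
rewrite /G; move/funext: gh; case: h {hP} => h [[h1] [h2]] /= gh.
subst h; rewrite /G /=; congr (GRing.Linear.Pack _).
by congr (GRing.Linear.Class _ _); [congr GRing.isNmodMorphism.Axioms_ |
  congr GRing.isScalable.Axioms_]; apply: Prop_irrelevance.
Qed.

End TensorAlgebra.

Fixpoint tens_pow (K : fieldType) (B : algType K) (n : nat) : algType K :=
  match n with
  | 0 => K^o
  | 1 => B
  | m.+1 => tens B (tens_pow B m)
  end.

Definition integrodiff (K : fieldType) (n : nat) : algType K := tens_pow (I1 K) n.

Section LeftOreMax.
Variable R : nzRingType.

Lemma left_ore_max_largest :
  [/\ left_ore_set (left_ore_max R), left_ore_max R `<=` regular_elements R
    & forall S, left_ore_set S -> S `<=` regular_elements R ->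
        S `<=` left_ore_max R].
Proof.
set U := left_ore_max R; set C := regular_elements R.
have C1 : C 1 by split; [exact: lreg1 | exact: rreg1].
have CM x y : C x -> C y -> C (x * y).
  by case=> lx rx [ly ry]; split; [exact: lregM | exact: rregM].
have UC : U `<=` C by move=> x [S [_ SC Sx]]; apply: SC.
pose M : set R := [set x | exists s : seq R,
  (forall y, y \in s -> U y) /\ x = \prod_(y <- s) y].
have MC : M `<=` C.
  move=> _ [s [sU ->]]; elim: s sU => [|y s IH] sU; first by rewrite big_nil.
  rewrite big_cons; apply: CM; first by apply/UC/sU; rewrite mem_head.
  by apply: IH => z zs; apply: sU; rewrite inE zs orbT.
have UM : U `<=` M.
  move=> x Ux; exists [:: x]; rewrite big_seq1; split=> // y.
  by rewrite inE => /eqP ->.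
have M1 : M 1 by exists [::]; rewrite big_nil.
have MM x y : M x -> M y -> M (x * y).
  move=> [s [sU ->]] [t [tU ->]]; exists (s ++ t); rewrite big_cat; split=> // z.
  by rewrite mem_cat => /orP[/sU|/tU].
have MO : left_ore_set M.
  split=> [|r _ [s [sU ->]]].
    split=> // /MC [/lreg_neq0]; by rewrite eqxx.
  elim: s sU r => [|y s IH] sU r.
    by exists 1, r; rewrite big_nil mul1r mulr1.
  have [|t [r' [Mt e]]] := IH _ r.
    by move=> z zs; apply: sU; rewrite inE zs orbT.
  have /sU Uy : y \in y :: s by rewrite mem_head.
  have [S [So SC Sy]] := Uy; have [t' [r'' [St' e']]] := So.2 r' y Sy.
  exists (t' * t), r''; split.
    by apply: MM => //; apply: UM; exists S.
  by rewrite big_cons -mulrA e !mulrA e'.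
have -> : U = M.
  apply/seteqP; split=> // x Mx; by exists M.
split=> // S So SC x Sx; apply: UM; by exists S.
Qed.

End LeftOreMax.

Section Converse.
Variable R : nzRingType.
Implicit Types S : set R.

Lemma right_ore_converse S : right_ore_set S <-> @left_ore_set R^c S.
Proof.
by split=> -[[S1 SM S0] So]; (split; first by split=> // s t Ss St; apply: SM).
Qed.

Lemma regular_converse : regular_elements R^c = regular_elements R.
Proof. by apply/seteqP; split=> x [lx rx]; split. Qed.

Lemma right_ore_max_converse : right_ore_max R = left_ore_max R^c.
Proof.
apply/seteqP; split=> x [S [So SC Sx]]; exists S; split=> //.
- exact/right_ore_converse.
- by rewrite regular_converse.
- exact/right_ore_converse.
- by rewrite regular_converse in SC.
Qed.

Lemma right_ore_max_largest :
  [/\ right_ore_set (right_ore_max R), right_ore_max R `<=` regular_elements R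
    & forall S, right_ore_set S -> S `<=` regular_elements R ->
        S `<=` right_ore_max R].
Proof.
rewrite right_ore_max_converse; have [h1 h2 h3] := left_ore_max_largest R^c.
split; first exact/right_ore_converse.
  by rewrite -regular_converse.
move=> S /right_ore_converse So SC; apply: h3 => //.
by rewrite regular_converse.
Qed.

End Converse.

(* The quotient ring S^-1 R, for a left Ore set [S] of regular elements:
   q in S^-1 R is represented by its graph {(a, b) | a q = b} in R x R. *)
Section LeftQuotient.
Variables (R : pzRingType) (S : set R).
Hypotheses (S_ore : left_ore_set S) (S_reg : S `<=` regular_elements R).

Record is_graph (g : R -> R -> Prop) : Prop := IsGraph {
  graphD : forall a b c d, g a b -> g c d -> g (a + c) (b + d);
  graphM : forall r a b, g a b -> g (r * a) (r * b);
  graph0 : forall b, g 0 b -> b = 0;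
  graph_dom : exists s b, S s /\ g s b;
  graph_sat : forall s a b, S s -> g (s * a) (s * b) -> g a b
}.

Record lfrac := LFrac { graph :> R -> R -> Prop; graphP : is_graph graph }.

HB.instance Definition _ := gen_eqMixin lfrac.
HB.instance Definition _ := gen_choiceMixin lfrac.

Let S1 : S 1. Proof. by case: S_ore => -[]. Qed.
Let SM s t : S s -> S t -> S (s * t).
Proof. by case: S_ore => -[_ + _] _; apply. Qed.
Let Sl s b : S s -> s * b = 0 -> b = 0.
Proof. by move=> /S_reg[lS _] e; apply: lS; rewrite e mulr0. Qed.

Definition saturate (h : R -> R -> Prop) a b := exists s, S s /\ h (s * a) (s * b).

Lemma saturateP h :
  (forall a b c d, h a b -> h c d -> h (a + c) (b + d)) ->
  (forall r a b, h a b -> h (r * a) (r * b)) ->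
  (forall b, h 0 b -> b = 0) ->
  (exists s b, S s /\ h s b) -> is_graph (saturate h).
Proof.
move=> hD hM h0 [s0 [b0 [Ss0 h00]]]; split.
- move=> a b c d [s [Ss hab]] [s' [Ss' hcd]].
  have [t [r [St e]]] := S_ore.2 s s' Ss'.
  exists (t * s); split; first exact: SM.
  rewrite !mulrDr; apply: hD; first by rewrite -!mulrA; apply: hM.
  by rewrite e -!mulrA; apply: hM.
- move=> r a b [s [Ss hab]]; have [t [r' [St e]]] := S_ore.2 r s Ss.
  by exists t; split=> //; rewrite !mulrA e -!mulrA; apply: hM.
- by move=> b [s [Ss]]; rewrite mulr0 => /h0; apply: Sl.
- by exists s0, b0; split=> //; exists 1; rewrite !mul1r.
- move=> s a b Ss [t [St]]; rewrite !mulrA => h1.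
  by exists (t * s); split=> //; apply: SM.
Qed.

Lemma graph_sub (h : R -> R -> Prop) a b : h a b -> saturate h a b.
Proof. by move=> hab; exists 1; rewrite !mul1r. Qed.

Lemma graph_fun (p : lfrac) a b c : p a b -> p a c -> b = c.
Proof.
move=> pb pc; apply/eqP; rewrite -subr_eq0; apply/eqP.
apply: (graph0 (graphP p)); rewrite -(subrr a) -mulN1r -[- c]mulN1r.
by apply: (graphD (graphP p)) => //; apply: (graphM (graphP p)).
Qed.

Lemma lfrac_eq (p q : lfrac) s b : S s -> p s b -> q s b -> p = q.
Proof.
move=> Ss ps qs.
have sub (u v : lfrac) a c : u s b -> v s b -> u a c -> v a c.
  move=> us vs uac; have [t [r [St e]]] := S_ore.2 a s Ss.
  apply: (graph_sat (graphP v) St).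
  rewrite (graph_fun (graphM (graphP u) t uac) (c := r * b)).
    by rewrite e; apply: (graphM (graphP v)).
  by rewrite e; apply: (graphM (graphP u)).
have e : graph p = graph q.
  by apply/funext => a; apply/funext => c; apply/propext; split; apply: sub.
case: p e {ps sub} => g gP /= e; subst g; case: q gP {qs} => g gP' gP /=.
by congr LFrac; apply: Prop_irrelevance.
Qed.

Lemma lfrac_def (p : lfrac) x : exists t b, S t /\ p (t * x) b.
Proof.
have [s [b [Ss ps]]] := graph_dom (graphP p).
have [t [r [St e]]] := S_ore.2 x s Ss.
by exists t, (r * b); rewrite e; split=> //; apply: (graphM (graphP p)).
Qed.

Lemma lfrac_def2 (p q : lfrac) x :
  exists t b c, [/\ S t, p (t * x) b & q (t * x) c].
Proof.
have [t [b [St pt]]] := lfrac_def p x.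
have [u [c [Su qu]]] := lfrac_def q (t * x).
exists (u * t), (u * b), c; rewrite -mulrA; split=> //; first exact: SM.
exact: (graphM (graphP p)).
Qed.

Lemma lfrac_def3 (p q w : lfrac) : exists t b c d, [/\ S t, p t b, q t c & w t d].
Proof.
have [t [b [c [St pt qt]]]] := lfrac_def2 p q 1.
have [u [d [Su wu]]] := lfrac_def w t; rewrite mulr1 in pt qt.
exists (u * t), (u * b), (u * c), d; split=> //; first exact: SM.
  exact: (graphM (graphP p)).
exact: (graphM (graphP q)).
Qed.

Fact lfrac_in_subproof r : is_graph (fun a b => b = a * r).
Proof.
split=> [a b c d -> ->|x a b ->|b ->||s a b Ss]; first by rewrite mulrDl.
- by rewrite mulrA.
- by rewrite mul0r.
- by exists 1, (1 * r).
by rewrite -mulrA => e; have [lS _] := S_reg Ss; apply: lS.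
Qed.
Definition lfrac_in r : lfrac := LFrac (lfrac_in_subproof r).

Definition add_graph (p q : lfrac) a b := exists c d, [/\ p a c, q a d & b = c + d].
Fact lfrac_add_subproof p q : is_graph (saturate (add_graph p q)).
Proof.
apply: saturateP.
- move=> a b c d [b1 [b2 [p1 q1 ->]]] [d1 [d2 [p2 q2 ->]]].
  exists (b1 + d1), (b2 + d2); split; last by rewrite addrACA.
    exact: (graphD (graphP p)).
  exact: (graphD (graphP q)).
- move=> r a b [c [d [pc qd ->]]]; exists (r * c), (r * d).
  rewrite mulrDr; split=> //; first exact: (graphM (graphP p)).
  exact: (graphM (graphP q)).
- move=> b [c [d [/(graph0 (graphP p)) -> /(graph0 (graphP q)) -> ->]]].
  by rewrite addr0.
have [t [b [c [St pt qt]]]] := lfrac_def2 p q 1; rewrite mulr1 in pt qt.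
by exists t, (b + c); split=> //; exists b, c.
Qed.
Definition lfrac_add p q : lfrac := LFrac (lfrac_add_subproof p q).

Definition mul_graph (p q : lfrac) a b := exists2 c, p a c & q c b.
Fact lfrac_mul_subproof p q : is_graph (saturate (mul_graph p q)).
Proof.
apply: saturateP.
- move=> a b c d [b1 p1 q1] [d1 p2 q2].
  exists (b1 + d1); first exact: (graphD (graphP p)).
  exact: (graphD (graphP q)).
- move=> r a b [c pc qd]; exists (r * c); first exact: (graphM (graphP p)).
  exact: (graphM (graphP q)).
- by move=> b [c /(graph0 (graphP p)) -> /(graph0 (graphP q)) ->].
have [t [b [St pt]]] := lfrac_def p 1; rewrite mulr1 in pt.
have [u [c [Su qu]]] := lfrac_def q b.
exists (u * t), c; split; first exact: SM.
by exists (u * b) => //; apply: (graphM (graphP p)).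
Qed.
Definition lfrac_mul p q : lfrac := LFrac (lfrac_mul_subproof p q).

Fact lfrac_opp_subproof (p : lfrac) : is_graph (fun a b => p a (- b)).
Proof.
split=> [a b c d pa pc|r a b pa|b /(graph0 (graphP p)) e||s a b Ss].
- by rewrite opprD; apply: (graphD (graphP p)).
- by rewrite -mulrN; apply: (graphM (graphP p)).
- by rewrite -[b]opprK e oppr0.
- have [s [b [Ss ps]]] := graph_dom (graphP p).
  by exists s, (- b); rewrite opprK.
by rewrite -mulrN; apply: (graph_sat (graphP p)).
Qed.
Definition lfrac_opp p : lfrac := LFrac (lfrac_opp_subproof p).

Lemma lfrac_addE (p q : lfrac) a c d :
  p a c -> q a d -> lfrac_add p q a (c + d).
Proof. by move=> pa qa; apply: graph_sub; exists c, d. Qed.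

Lemma lfrac_mulE (p q : lfrac) a c d : p a c -> q c d -> lfrac_mul p q a d.
Proof. by move=> pa qc; apply: graph_sub; exists c. Qed.

Lemma lfrac_def1 (p : lfrac) : exists t b, S t /\ p t b.
Proof. exact: graph_dom (graphP p). Qed.

Fact lfrac_addA : associative lfrac_add.
Proof.
move=> p q w; have [t [b [c [d [St pt qt wt]]]]] := lfrac_def3 p q w.
apply: (lfrac_eq (b := b + c + d) St); last by do 2?apply: lfrac_addE.
by rewrite -addrA; do 2?apply: lfrac_addE.
Qed.
Fact lfrac_addC : commutative lfrac_add.
Proof.
move=> p q; have [t [b [c [d [St pt qt _]]]]] := lfrac_def3 p q q.
apply: (lfrac_eq (b := b + c) St); first exact: lfrac_addE.
by rewrite addrC; apply: lfrac_addE.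
Qed.
Fact lfrac_add0 : left_id (lfrac_in 0) lfrac_add.
Proof.
move=> p; have [t [b [St pt]]] := lfrac_def1 p.
apply: (lfrac_eq (b := b) St) => //; rewrite -[b]add0r.
by apply: lfrac_addE => //=; rewrite mulr0.
Qed.
Fact lfrac_addN : left_inverse (lfrac_in 0) lfrac_opp lfrac_add.
Proof.
move=> p; have [t [b [St pt]]] := lfrac_def1 p.
apply: (lfrac_eq (b := - b + b) St); last by rewrite /= mulr0 addNr.
by apply: lfrac_addE => //=; rewrite opprK.
Qed.
HB.instance Definition _ := GRing.isZmodule.Build lfrac
  lfrac_addA lfrac_addC lfrac_add0 lfrac_addN.

Fact lfrac_mulA : associative lfrac_mul.
Proof.
move=> p q w; have [t [b [St pt]]] := lfrac_def1 p.
have [u [c [Su qu]]] := lfrac_def q b; have [v [d [Sv wv]]] := lfrac_def w c.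
have pvut : p (v * (u * t)) (v * (u * b)) by do 2!apply: (graphM (graphP p)).
have qv : q (v * (u * b)) (v * c) by apply: (graphM (graphP q)).
apply: (lfrac_eq (s := v * (u * t)) (b := d)); first by do 2?apply: SM.
  by apply: (lfrac_mulE pvut); apply: (lfrac_mulE qv).
exact: (lfrac_mulE (lfrac_mulE pvut qv)).
Qed.
Fact lfrac_mul1l : left_id (lfrac_in 1) lfrac_mul.
Proof.
move=> p; have [t [b [St pt]]] := lfrac_def1 p.
apply: (lfrac_eq (b := b) St) => //; apply: (lfrac_mulE (c := t)) => //=.
by rewrite mulr1.
Qed.
Fact lfrac_mul1r : right_id (lfrac_in 1) lfrac_mul.
Proof.
move=> p; have [t [b [St pt]]] := lfrac_def1 p.
apply: (lfrac_eq (b := b) St) => //; apply: (lfrac_mulE pt) => /=.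
by rewrite mulr1.
Qed.
Fact lfrac_mulDl : left_distributive lfrac_mul +%R.
Proof.
move=> p q w; have [t [b [c [St pt qt]]]] := lfrac_def2 p q 1.
rewrite mulr1 in pt qt.
have [u [d [Su wu]]] := lfrac_def w b; have [v [e [Sv wv]]] := lfrac_def w (u * c).
have wvu : w (v * (u * b)) (v * d) by apply: (graphM (graphP w)).
have pvut : p (v * (u * t)) (v * (u * b)) by do 2!apply: (graphM (graphP p)).
have qvut : q (v * (u * t)) (v * (u * c)) by do 2!apply: (graphM (graphP q)).
apply: (lfrac_eq (s := v * (u * t)) (b := v * d + e)); first by do 2?apply: SM.
  apply: (lfrac_mulE (lfrac_addE pvut qvut)).
  exact: (graphD (graphP w)).
by apply: lfrac_addE; [exact: (lfrac_mulE pvut) | exact: (lfrac_mulE qvut)].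
Qed.
Fact lfrac_mulDr : right_distributive lfrac_mul +%R.
Proof.
move=> p q w; have [t [b [St pt]]] := lfrac_def1 p.
have [u [c [d [Su qu wu]]]] := lfrac_def2 q w b.
have put : p (u * t) (u * b) by apply: (graphM (graphP p)).
apply: (lfrac_eq (s := u * t) (b := c + d)); first exact: SM.
  by apply: (lfrac_mulE put); apply: lfrac_addE.
by apply: lfrac_addE; apply: (lfrac_mulE put).
Qed.
HB.instance Definition _ := GRing.Zmodule_isPzRing.Build lfrac
  lfrac_mulA lfrac_mul1l lfrac_mul1r lfrac_mulDl lfrac_mulDr.

Fact lfrac_in_zmod_morphism : zmod_morphism lfrac_in.
Proof.
move=> x y; apply: (lfrac_eq S1 (b := x - y)) => /=; first by rewrite mul1r.
by apply: lfrac_addE => /=; rewrite ?opprK mul1r.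
Qed.
Fact lfrac_in_monoid_morphism : monoid_morphism lfrac_in.
Proof.
split=> // x y; apply: (lfrac_eq S1 (b := x * y)) => /=; first by rewrite mul1r.
by apply: (lfrac_mulE (c := x)) => /=; rewrite ?mul1r.
Qed.
HB.instance Definition _ := GRing.isZmodMorphism.Build R lfrac lfrac_in
  lfrac_in_zmod_morphism.
HB.instance Definition _ := GRing.isMonoidMorphism.Build R lfrac lfrac_in
  lfrac_in_monoid_morphism.

Fact lfrac_inv_subproof s : S s -> is_graph (saturate (fun a b => a = b * s)).
Proof.
move=> Ss; apply: saturateP => [a b c d -> ->|r a b ->|b e|].
- by rewrite mulrDl.
- by rewrite mulrA.
- by have [_ rS] := S_reg Ss; apply: rS; rewrite mul0r.
by exists s, 1; rewrite mul1r.
Qed.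
Definition lfrac_inv s (Ss : S s) : lfrac := LFrac (lfrac_inv_subproof Ss).

Lemma lfrac_is_quotient : is_left_quotient_ring S (lfrac_in : {rmorphism R -> lfrac}).
Proof.
have invE s (Ss : S s) : lfrac_inv Ss s 1 by apply: graph_sub; rewrite mul1r.
split=> [s Ss|q|r].
- exists (lfrac_inv Ss); split.
    apply: (lfrac_eq (s := s) (b := s)) => //=; last by rewrite mulr1.
    by apply: (lfrac_mulE (invE s Ss)) => /=; rewrite mul1r.
  apply: (lfrac_eq (s := 1) (b := 1)) => //=; last by rewrite mulr1.
  by apply: (lfrac_mulE (c := s) _ (invE s Ss)); exact: esym (mul1r s).
- have [t [b [St qt]]] := lfrac_def1 q; exists t, b; split=> //.
  apply: (lfrac_eq (s := 1) (b := b)) => //=; last by rewrite mul1r.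
  by apply: (lfrac_mulE (c := t)) => //=; rewrite mul1r.
split=> [e|[s Ss /(Sl Ss) ->]]; last by rewrite rmorph0.
have : graph (lfrac_in r) 1 r by exact: esym (mul1r r).
have {}e : lfrac_in r = lfrac_in 0 := e.
rewrite {}e => e; have {e} : r = 1 * 0 := e; rewrite mulr0 => ->.
by exists 1; rewrite ?mulr0.
Qed.

Lemma left_quotient_ring_exists :
  exists (Q : pzRingType) (i : {rmorphism R -> Q}), is_left_quotient_ring S i.
Proof. by exists lfrac, lfrac_in; exact: lfrac_is_quotient. Qed.

End LeftQuotient.

Lemma right_quotient_ring_exists (R : nzRingType) (S : set R) :
  right_ore_set S -> S `<=` regular_elements R ->
  exists (Q : pzRingType) (i : {rmorphism R -> Q}), is_right_quotient_ring S i.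
Proof.
move=> /right_ore_converse So; rewrite -regular_converse => SC.
have [Q [i [iS iQ i0]]] := left_quotient_ring_exists So SC.
have iD : zmod_morphism (i : R -> Q^c) by move=> x y; apply: (raddfB i).
have iM : monoid_morphism (i : R -> Q^c).
  by split=> [|x y]; [apply: (rmorph1 i) | apply: (rmorphM i y x)].
pose j : {rmorphism R -> Q^c} := HB.pack (i : R -> Q^c)
  (GRing.isZmodMorphism.Build R Q^c (i : R -> Q^c) iD)
  (GRing.isMonoidMorphism.Build R Q^c (i : R -> Q^c) iM).
exists Q^c, j; split=> //.
by move=> s /iS[u [u1 u2]]; exists u.
Qed.

(* Main.v *)
Require Import Defs.
From HB Require Import structures.
From mathcomp Require Import all_boot all_algebra.
From mathcomp Require Import boolp classical_sets.

Set Implicit Arguments.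
Unset Strict Implicit.
Unset Printing Implicit Defensive.

Import GRing.Theory.

Local Open Scope classical_set_scope.
Local Open Scope ring_scope.

(** Everything is deduced from one feature of the ring R of the theorem: it
    contains D and J (the images of d/dx and of integration) with D * J = 1,
    and e = 1 - J * D is a nonzero idempotent such that the elements
    J ^+ j * e * D ^+ m behave like matrix units. An element r is read as the
    infinite matrix with entries e * D ^+ j * r * J ^+ m * e, and in R
    - an element whose entries all vanish is zero;
    - each matrix is banded: its entries vanish far from the diagonal.
    Such a pair is called a shift pair. The notion is left-right symmetric
    (D and J are exchanged in the converse ring, [shift_pair_converse]), so the
    right-hand statements are the left-hand ones for the converse ring.

    Regular elements are not left Ore ([regular_not_left_ore]). The element
    1 - D is regular: if b = D * b then b = D ^+ k * b for all k, which moves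
    every entry of b out of the band; if b = b * D, then b = b * D ^+ m.+1 kills
    J ^+ m * e for every m. Now suppose that c * e = a * (1 - D) with c regular.
    Formally a = c * e * (1 + D + D ^+ 2 + ...), whose matrix has all its columns
    equal to the column of c * e: bandedness of a forces c * e = 0, hence e = 0,
    a contradiction. In a ring where a classical left quotient ring exists the
    regular elements are left Ore, so there is none either.

    The largest left quotient ring Q contains an infinite direct sum of left
    ideals simply because R embeds in Q and the J ^+ k * e * D ^+ k are nonzero
    orthogonal idempotents ([shift_pair_left_quotient]); the partial sums of
    the ideals that they generate form a strictly increasing chain.

    Finally, d/dx and integration form a shift pair in the algebra of polynomial
    integro-differential operators ([I1_shift_pair]): up to nonzero factors, the
    entries of an operator are its coefficients in the basis of monomials, and
    bandedness is inherited from the three generators. Shift pairs pass to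
    tensor products ([shift_pair_tens]), which reaches every n and A. *)

(** * Shift pairs *)

Section ShiftPair.
Variables (R : nzRingType) (D J : R).

Definition entry (r : R) (j m : nat) : R :=
  (1 - J * D) * D ^+ j * r * J ^+ m * (1 - J * D).

Record shift_pair : Prop := ShiftPair {
  shift_retract : D * J = 1;
  shift_banded : forall r, exists N, forall j m,
    (j + N < m)%N || (m + N < j)%N -> entry r j m = 0;
  shift_faithful : forall r, (forall j m, entry r j m = 0) -> r = 0
}.

End ShiftPair.

Lemma expr_converse (R : nzRingType) (x : R) k : (x : R^c) ^+ k = x ^+ k.
Proof. by elim: k => // k IH; rewrite exprS exprSr IH. Qed.

(** Passing to the converse ring transposes the matrices. *)
Lemma shift_pair_converse (R : nzRingType) (D J : R) :
  shift_pair D J -> @shift_pair R^c J D.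
Proof.
case=> DJ band faithful.
have entryE (r : R) j m : @entry R^c J D r j m = entry D J r m j.
  have -> : entry D J r m j =
      (1 - J * D) * (D ^+ m * (r * (J ^+ j * (1 - J * D)))).
    by rewrite /entry !mulrA.
  by rewrite /entry !expr_converse.
split=> // [r|r r0].
  have [N rN] := band r; exists N => j m; rewrite orbC entryE; exact: rN.
by apply: faithful => j m; rewrite -entryE.
Qed.

(** * Regular elements and idempotents of a ring with a shift pair *)

Section ShiftPairTheory.
Variables (R : nzRingType) (D J : R).
Hypothesis DJ : shift_pair D J.

Let e : R := 1 - J * D.

Let D_e : D * e = 0.
Proof. by rewrite mulrBr mulr1 mulrA (shift_retract DJ) mul1r subrr. Qed.

Let e_J : e * J = 0.
Proof. by rewrite mulrBl mul1r -mulrA (shift_retract DJ) mulr1 subrr. Qed.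

Let e_idem : e * e = e.
Proof. by rewrite {2}/e mulrBr mulr1 mulrA e_J mul0r subr0. Qed.

Let e_JXS m : e * J ^+ m.+1 = 0.
Proof. by rewrite exprS mulrA e_J mul0r. Qed.

Let D_JXS m : D * J ^+ m.+1 = J ^+ m.
Proof. by rewrite exprS mulrA (shift_retract DJ) mul1r. Qed.

Let DX_e m : D ^+ m.+1 * e = 0.
Proof. by rewrite exprSr -mulrA D_e mulr0. Qed.

Let DX_JX m : D ^+ m * J ^+ m = 1.
Proof. by elim: m => [|m IH]; rewrite ?mulr1 // exprSr -mulrA D_JXS IH. Qed.

Let e_neq0 : e <> 0.
Proof.
move=> e0; have /eqP := oner_neq0 R; apply; apply: (shift_faithful DJ) => j m.
by rewrite /entry -/e e0 !mul0r.
Qed.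

Lemma eq0_on_columns b : (forall m, b * J ^+ m * e = 0) -> b = 0.
Proof.
move=> b0; apply: (shift_faithful DJ) => j m.
by rewrite /entry -/e -2!mulrA (mulrA b) b0 mulr0.
Qed.

Lemma one_sub_mul_eq0 b : (1 - D) * b = 0 -> b = 0.
Proof.
move=> /eqP; rewrite mulrBl mul1r subr_eq0 => /eqP bD.
have bDX k : D ^+ k * b = b.
  by elim: k => [|k IH]; rewrite ?mul1r // exprSr -mulrA -bD.
have [N bN] := shift_banded DJ b; apply: (shift_faithful DJ) => j m.
(* the entries of D ^+ k * b are those of b, moved by k rows *)
rewrite -(bN (j + (m + N).+1)%N m); last by rewrite (ltn_addl j (ltnSn _)) orbT.
rewrite /entry; congr (_ * _ * _).
by rewrite exprD -!mulrA !bDX.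
Qed.

Lemma mul_one_sub_eq0 b : b * (1 - D) = 0 -> b = 0.
Proof.
move=> /eqP; rewrite mulrBr mulr1 subr_eq0 => /eqP bD.
have bDX k : b * D ^+ k = b.
  by elim: k => [|k IH]; rewrite ?mulr1 // exprS mulrA -bD.
apply: eq0_on_columns => m; rewrite -(bDX m.+1) -mulrA -mulrA exprS.
by rewrite (mulrA (_ * _)) -(mulrA D) DX_JX mulr1 D_e mulr0.
Qed.

Lemma one_sub_regular : regular_elements R (1 - D).
Proof.
split=> x y /= /eqP; rewrite -subr_eq0 -?mulrBr -?mulrBl => /eqP.
  by move=> /one_sub_mul_eq0/eqP; rewrite subr_eq0 => /eqP.
by move=> /mul_one_sub_eq0/eqP; rewrite subr_eq0 => /eqP.
Qed.

(** The left Ore condition fails for the pair r = e, s = 1 - D: a solution a of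
    c * e = a * (1 - D) would have all its columns equal. *)
Lemma regular_not_left_ore : ~ left_ore_set (regular_elements R).
Proof.
case=> _ /(_ e _ one_sub_regular)[c [a [[cl _] ca]]].
have aJ m : a * J ^+ m * e = c * e.
  elim: m => [|m <-].
    by rewrite mulr1 -{2}e_idem mulrA ca -mulrA mulrBl mul1r D_e subr0.
  have aE : a = c * e + a * D by rewrite ca mulrBr mulr1 subrK.
  by rewrite {1}aE mulrDl -(mulrA c) -(mulrA a) D_JXS e_JXS mulr0 add0r.
have ce0 : c * e = 0.
  (* a nonzero entry of c * e would repeat along a whole row of a *)
  have [N aN] := shift_banded DJ a.
  have col j : e * D ^+ j * (c * e) = 0.
    rewrite -(aJ (j + N).+1) -(aN j (j + N).+1) ?leqnn //.
    by rewrite /entry -/e !mulrA.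
  apply: eq0_on_columns => -[|m]; last by rewrite -(mulrA c) e_JXS mulr0 mul0r.
  rewrite mulr1 -mulrA e_idem.
  apply: (shift_faithful DJ) => j m.
  by rewrite /entry -/e col !mul0r.
by apply: e_neq0; apply: cl; rewrite /= ce0 mulr0.
Qed.

Lemma diag_idem_orthogonal k l :
  (J ^+ k * e * D ^+ k) * (J ^+ l * e * D ^+ l) =
  if k == l then J ^+ k * e * D ^+ k else 0.
Proof.
have mid : e * D ^+ k * (J ^+ l * e) = if k == l then e else 0.
  rewrite mulrA -(mulrA e); have [kl|lk|<-] := ltngtP k l; last 1 first.
  - by rewrite DX_JX mulr1.
  - by rewrite -(subnKC kl) addSnnS exprD (mulrA (D ^+ k)) DX_JX mul1r e_JXS mul0r.
  rewrite -(subnK lk) -addSnnS exprD -(mulrA _ (D ^+ l)) DX_JX mulr1.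
  by rewrite -mulrA DX_e mulr0.
transitivity (J ^+ k * (e * D ^+ k * (J ^+ l * e)) * D ^+ l).
  by rewrite !mulrA.
by rewrite mid; case: eqP => [->|_]; rewrite ?mulr0 ?mul0r.
Qed.

Lemma diag_idem_neq0 k : J ^+ k * e * D ^+ k <> 0.
Proof.
move=> E0; apply: e_neq0; rewrite -[e]mulr1 -(DX_JX k) -[LHS]mul1r -(DX_JX k).
transitivity (D ^+ k * (J ^+ k * e * D ^+ k) * J ^+ k); first by rewrite !mulrA.
by rewrite E0 mulr0 mul0r.
Qed.

End ShiftPairTheory.

(** * Infinite direct sums of left ideals *)

Section InfiniteDirectSums.
Variable R : pzRingType.

Lemma idempotents_direct_sum (f : nat -> R) :
  (forall k l, f k * f l = if k == l then f k else 0) ->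
  (forall k, f k <> 0) -> has_infinite_direct_sum_of_left_ideals R.
Proof.
move=> ff f0.
(* the left ideal generated by f k, as the elements that f k fixes *)
exists (fun k => [set x | x * f k = x]); split.
- move=> k; split=> /= [|x y xk yk|r x xk]; first by rewrite mul0r.
    by rewrite mulrDl xk yk.
  by rewrite -mulrA xk.
- by move=> k; exists (f k) => //=; rewrite ff eqxx.
move=> m x xI x0 k; rewrite -(xI k) -[RHS](mul0r (f k)) -x0 mulr_suml.
rewrite (bigD1 k) //= big1 ?addr0 // => l lk.
by rewrite -(xI l) -mulrA ff val_eqE (negPf lk) mulr0.
Qed.

(** If the partial sums of the ideals were stationary at k, a nonzero element of
    the ideal of index k would be a sum of elements of the previous ones. *)
Lemma infinite_direct_sum_not_noetherian :
  has_infinite_direct_sum_of_left_ideals R -> ~ left_noetherian R.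
Proof.
case=> I [Ileft Ineq0 Iind] noeth.
pose P k : set R := [set x | exists2 y : nat -> R,
  (forall l, I l (y l)) & x = \sum_(l < k) y l].
have [k|k _ [y yI ->]|k kP] := noeth P.
- split; first by exists (fun=> 0); rewrite ?big1 // => l; have [] := Ileft l.
    move=> _ _ [y yI ->] [z zI ->]; exists (fun l => y l + z l).
      by move=> l; have [_ ID _] := Ileft l; apply: ID.
    by rewrite big_split.
  move=> r _ [y yI ->]; exists (fun l => r * y l); last by rewrite mulr_sumr.
  by move=> l; have [_ _ IM] := Ileft l; apply: IM.
- exists (fun l => if (l < k)%N then y l else 0).
    by move=> l; case: ifP => // _; have [] := Ileft l.
  rewrite big_ord_recr /= ltnn addr0; apply: eq_bigr => l _.
  by rewrite ltn_ord.
have [z zI z0] := Ineq0 k; apply: z0.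
have : P k.+1 z.
  exists (fun l => if l == k then z else 0).
    by move=> l; case: eqP => [->|_] //; have [] := Ileft l.
  rewrite big_ord_recr /= eqxx big1 ?add0r // => l _.
  by rewrite (ltn_eqF (ltn_ord l)).
rewrite (kP k.+1 (leqnSn k)) => -[y yI zE].
pose x (l : 'I_k.+1) := if (l < k)%N then y l else - z.
have : x ord_max = 0.
  apply: Iind => [l|].
    rewrite /x; case: ifP => // /negbT; rewrite -leqNgt => kl.
    have -> : l = k :> nat by apply/eqP; rewrite eqn_leq kl -ltnS ltn_ord.
    by have [_ _ IM] := Ileft k; rewrite -mulN1r; apply: IM.
  rewrite big_ord_recr /= /x ltnn [X in _ - X]zE; apply/eqP.
  by rewrite subr_eq0; apply/eqP/eq_bigr => l _ /=; rewrite ltn_ord.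
by rewrite /x /= ltnn => /eqP; rewrite oppr_eq0 => /eqP.
Qed.

End InfiniteDirectSums.

(** * Quotient rings *)

(** Writing the fraction r * s^-1 as s'^-1 * r' gives s' * r = r' * s up to the
    kernel of the localization map, that is, up to a regular left factor. *)
Lemma left_quotient_ring_regular_ore (R : nzRingType) (Q : pzRingType)
    (i : {rmorphism R -> Q}) :
  is_left_quotient_ring (regular_elements R) i ->
  left_ore_set (regular_elements R).
Proof.
case=> iV iQ i0.
have CM (x y : R) : regular_elements R x -> regular_elements R y ->
    regular_elements R (x * y).
  by case=> lx rx [ly ry]; split; [exact: lregM | exact: rregM].
split=> [|r s Cs].
  split=> //; first by split; [exact: lreg1 | exact: rreg1].
  by case=> /lreg_neq0; rewrite eqxx.
have [u [us su]] := iV s Cs; have [s' [r' [Cs' s'r']]] := iQ (i r * u).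
have [|t Ct] := (i0 (s' * r - r' * s)).1.
  by rewrite rmorphB !rmorphM -s'r' -!mulrA us mulr1 subrr.
rewrite mulrBr !mulrA => /eqP; rewrite subr_eq0 => /eqP e.
by exists (t * s'), (t * r'); split=> //; apply: CM.
Qed.

(** The largest left Ore set consists of regular elements, so R embeds in Q and
    the diagonal idempotents of R stay nonzero in Q. *)
Lemma shift_pair_left_quotient (R : nzRingType) (D J : R) (Q : pzRingType)
    (i : {rmorphism R -> Q}) :
  shift_pair D J -> is_left_quotient_ring (left_ore_max R) i ->
  has_infinite_direct_sum_of_left_ideals Q.
Proof.
move=> DJ [_ _ i0].
have i_inj r : i r = 0 -> r = 0.
  move=> /i0[s Ss sr0]; have [_ /(_ s Ss)[ls _] _] := left_ore_max_largest R.
  by apply: ls; rewrite /= sr0 mulr0.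
apply: (@idempotents_direct_sum _
  (fun k => i (J ^+ k * (1 - J * D) * D ^+ k))) => [k l|k].
  rewrite -rmorphM (diag_idem_orthogonal DJ); case: eqP => // _.
  by rewrite rmorph0.
by move/i_inj; apply: diag_idem_neq0.
Qed.

Lemma right_quotient_ring_converse (R Q : pzRingType) (S : set R)
    (i : {rmorphism R -> Q}) : is_right_quotient_ring S i ->
  exists j : {rmorphism R^c -> Q^c}, @is_left_quotient_ring R^c Q^c S j.
Proof.
case=> iV iQ i0.
have iD : zmod_morphism (i : R^c -> Q^c) by move=> x y; apply: (raddfB i).
have iM : monoid_morphism (i : R^c -> Q^c).
  by split=> [|x y]; [apply: (rmorph1 i) | apply: (rmorphM i y x)].
pose j : {rmorphism R^c -> Q^c} := HB.pack (i : R^c -> Q^c)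
  (GRing.isZmodMorphism.Build R^c Q^c (i : R^c -> Q^c) iD)
  (GRing.isMonoidMorphism.Build R^c Q^c (i : R^c -> Q^c) iM).
exists j; split=> //.
by move=> s /iV[u [us su]]; exists u.
Qed.

(** * Shift pairs in tensor products *)

Section TensorSlices.
Variables (K : fieldType) (T B : algType K).

Lemma pureDl a a' (b : B) : pure (a + a' : T) b = pure a b + pure a' b.
Proof. by have := (pure_bilinear T B).1 b 1 a a'; rewrite !scale1r. Qed.

Lemma pure0l (b : B) : pure (0 : T) b = 0.
Proof. by rewrite -[LHS](addrK (pure 0 b)) -pureDl addr0 subrr. Qed.

Lemma slice_bilinear (g : {linear B -> K^o}) :
  bilinear_map (fun (a : T) (b : B) => g b *: a).
Proof.
split=> [b|a] c u v; first by rewrite scalerDr !scalerA mulrC.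
by rewrite linearP scalerDl scalerA.
Qed.

(** This is the map id (x) g. *)
Definition slice (g : {linear B -> K^o}) (x : tens T B) : T :=
  tens_sum (fun a b => g b *: a) (repr x).

Lemma slice_of g s : slice g (tens_of s) = \sum_(p <- s) g p.2 *: p.1.
Proof. exact: tens_sum_repr (slice_bilinear g). Qed.

Lemma slice_pureM g a c (x : tens T B) :
  slice g (pure a 1 * x * pure c 1) = a * slice g x * c.
Proof.
have [s ->] := tens_surj x; rewrite /pure !tens_ofM !slice_of.
rewrite big_allpairs_dep big_allpairs_dep big_seq1 /= mulr_sumr mulr_suml.
apply: eq_bigr => p _; rewrite big_seq1 /= mul1r mulr1.
by rewrite -scalerAr -scalerAl.
Qed.

Lemma functional_separates (V : lmodType K) (v : V) :
  (forall g : {linear V -> K^o}, g v = 0) -> v = 0.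
Proof.
move=> v0; apply/eqP/contraT => /exists_functional[f [flin f1]].
pose F : {linear V -> K^o} := HB.pack f (GRing.isLinear.Build K V K^o _ f flin).
by have /eqP := v0 F; rewrite /= f1 oner_eq0.
Qed.

(** Induction on the number of terms. If a <> 0 is the first factor of the first
    term (a, b), a functional H with H a = 1, applied to all the slices, shows
    that b is a combination of the other second factors; the term (a, b) is then
    absorbed by the others. *)
Lemma slices_separate (x : tens T B) :
  (forall g : {linear B -> K^o}, slice g x = 0) -> x = 0.
Proof.
have [s ->] := tens_surj x; elim: {s}(size s) {-2}s (leqnn (size s)) => [|m IH].
  by case.
case=> [//|[a b] s] /=; rewrite ltnS => sm slice0.
have [a0|/exists_functional[h [hlin ha]]] := eqVneq a 0.
  have e : tens_of ((a, b) :: s) = tens_of s.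
    by rewrite !tens_ofE big_cons /= a0 pure0l add0r.
  by rewrite e; apply: IH => // g; rewrite -e.
pose H : {linear T -> K^o} := HB.pack h (GRing.isLinear.Build K T K^o _ h hlin).
(* H applied to the slices expresses b by the other second factors *)
have bE : b = - \sum_(p <- s) H p.1 *: p.2.
  apply/eqP; rewrite -addr_eq0; apply/eqP/functional_separates => g.
  have gb : H (slice g (tens_of ((a, b) :: s))) = 0 by rewrite slice0 linear0.
  rewrite -[RHS]gb slice_of big_cons 2!linearD 2!linear_sum; congr (_ + _).
    by rewrite linearZ /= ha [RHS]mulr1.
  by apply: eq_bigr => p _; rewrite 2!linearZ /= [RHS]mulrC.
pose s' := [seq (p.1 - H p.1 *: a, p.2) | p <- s].
have e : tens_of ((a, b) :: s) = tens_of s'.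
  apply/tens_ofP => V f [fl fr]; rewrite /tens_sum big_cons big_map /=.
  pose fa : {linear B -> V} := HB.pack (f a)
    (GRing.isLinear.Build K B V _ (f a) (fr a)).
  have -> : f a b = - \sum_(p <- s) H p.1 *: f a p.2.
    rewrite bE -[f a]/(fa : B -> V) linearN linear_sum; congr (- _).
    by apply: eq_bigr => p _; rewrite linearZ.
  rewrite addrC -sumrB; apply: eq_bigr => p _.
  rewrite addrC -scaleNr (addrC p.1) -[in RHS]scaleNr.
  exact/esym/(fl p.2 (- H p.1) a p.1).
by rewrite e; apply: IH => [|g]; [rewrite size_map | rewrite -e].
Qed.

End TensorSlices.

Section ShiftPairTensor.
Variables (K : fieldType) (T B : algType K) (D J : T).

Lemma pureX (a : T) k : pure a (1 : B) ^+ k = pure (a ^+ k) 1.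
Proof. by elim: k => // k IH; rewrite !exprS IH pureM mul1r. Qed.

Lemma entry_tens (x : tens T B) j m :
  entry (pure D 1) (pure J 1) x j m =
  pure ((1 - J * D) * D ^+ j) 1 * x * pure (J ^+ m * (1 - J * D)) 1.
Proof.
have e : 1 - pure J 1 * pure D 1 = pure (1 - J * D) (1 : B).
  by apply/eqP; rewrite subr_eq pureM mul1r -pureDl subrK.
by rewrite /entry !pureX e pureM mulr1 -mulrA pureM mulr1.
Qed.

(** Slices are compatible with multiplication by the first factor, so a tensor
    with zero entries has slices with zero entries, and these are zero. *)
Lemma shift_pair_tens :
  shift_pair D J -> shift_pair (pure D 1 : tens T B) (pure J 1).
Proof.
case=> DJ band faithful; split=> [|x|x x0].
- by rewrite pureM DJ mulr1.
- have [s ->] := tens_surj x; rewrite tens_ofE.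
  elim: s => [|[a b] s [N sN]].
    by exists 0 => j m _; rewrite big_nil entry_tens mulr0 mul0r.
  have [M aM] := band a; exists (maxn M N) => j m jm.
  have le k l : (k + maxn M N < l -> (k + M < l) && (k + N < l))%N.
    by move=> kl; apply/andP; split; apply: leq_ltn_trans kl;
      rewrite leq_add2l leq_max leqnn ?orbT.
  rewrite big_cons /= entry_tens mulrDr mulrDl -!entry_tens sN ?addr0; last first.
    by case/orP: jm => /le/andP[_ ->]; rewrite ?orbT.
  rewrite entry_tens !pureM mul1r mulr1.
  have -> : (1 - J * D) * D ^+ j * a * (J ^+ m * (1 - J * D)) = 0.
    rewrite mulrA; apply: aM.
    by case/orP: jm => /le/andP[-> _]; rewrite ?orbT.
  exact: pure0l.
apply: slices_separate => g; apply: faithful => j m.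
have := slice_pureM g ((1 - J * D) * D ^+ j) (J ^+ m * (1 - J * D)) x.
rewrite -entry_tens x0 /entry !mulrA => <-.
by rewrite (slice_of g [::]) big_nil.
Qed.

End ShiftPairTensor.

(** * Integro-differential operators *)

Section IntegroDifferential.
Variables (K : fieldType) (charK : [pchar K] =i pred0).
Implicit Types f g : polyEnd K.

Definition banded f := exists N, forall j m,
  (j + N < m)%N || (m + N < j)%N -> (f 'X^m)`_j = 0.

Lemma banded_leq f N M : (N <= M)%N ->
  (forall j m, (j + N < m)%N || (m + N < j)%N -> (f 'X^m)`_j = 0) ->
  forall j m, (j + M < m)%N || (m + M < j)%N -> (f 'X^m)`_j = 0.
Proof.
move=> NM fN j m jm; apply: fN.
by case/orP: jm => h; apply/orP; [left | right];
  apply: leq_ltn_trans h; rewrite leq_add2l.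
Qed.

Lemma polyEnd_expand f p : f p = \sum_(k < size p) p`_k *: f 'X^k.
Proof.
rewrite -{1}[p]coefK poly_def linear_sum.
by apply: eq_bigr => k _; rewrite linearZ.
Qed.

Lemma banded_subalg : GRing.subalg_closed (fun f => `[< banded f >]).
Proof.
split=> [|a f g|f g].
- apply/asboolP; exists 0 => j m; rewrite !addn0 /= coefXn => jm.
  by rewrite -neq_ltn in jm; rewrite (negPf jm).
- move=> /asboolP[N fN] /asboolP[M gM]; apply/asboolP; exists (maxn N M) => j m jm.
  rewrite coefD coefZ (banded_leq (leq_maxl N M) fN) //.
  by rewrite (banded_leq (leq_maxr N M) gM) // mulr0 addr0.
move=> /asboolP[N fN] /asboolP[M gM]; apply/asboolP; exists (N + M)%N => j m jm.
rewrite polyEnd_mulE polyEnd_expand coef_sum big1 // => k _; rewrite coefZ.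
have [km|km] := boolP ((k + M < m) || (m + M < k))%N.
  by rewrite gM ?mul0r.
rewrite fN ?mulr0 //; move: km; rewrite negb_or -!leqNgt => /andP[mk km].
case/orP: jm => h; apply/orP; [left | right].
  by rewrite -(ltn_add2r M) -addnA (leq_trans h).
by apply: leq_ltn_trans h; rewrite (addnC N) addnA leq_add2r.
Qed.

Lemma shiftXn_banded f :
  (forall m, exists c k, [/\ f 'X^m = c *: 'X^k, (k <= m.+1)%N & (m <= k.+1)%N]) ->
  banded f.
Proof.
move=> fX; exists 1%N => j m; rewrite !addn1 => jm.
have [c [k [-> km mk]]] := fX m; rewrite coefZ coefXn.
case: eqP jm => [->|_ _]; last by rewrite mulr0.
by rewrite !ltnNge mk km.
Qed.

Lemma I1_banded (f : I1 K) : banded f.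
Proof.
case: f => f /= /asboolP/(_ _ banded_subalg) fG; apply/asboolP/fG => g gG.
apply/asboolP/shiftXn_banded => m; case: gG => ->.
- by exists 1, m.+1; rewrite scale1r /= -exprS; split=> //; apply: leqW.
- exists m%:R, m.-1; rewrite /= derivXn scaler_nat; split=> //.
    by rewrite leqW // leq_pred.
  exact: leqSpred.
- by exists m.+1%:R^-1, m.+1; rewrite op_intXn; split=> //; apply/leqW.
Qed.

Definition I1_d : I1 K := MkI1 (mem_gen_subalg (Or32 _ _ (erefl (op_d K)))).
Definition I1_int : I1 K := MkI1 (mem_gen_subalg (Or33 _ _ (erefl (op_int K)))).

Lemma natrS_neq0 k : k.+1%:R != 0 :> K.
Proof. by rewrite ((pcharf0P K).1 charK). Qed.

Lemma I1_d_int : I1_d * I1_int = 1.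
Proof.
apply/val_inj/polyEndP => p; apply/polyP => k.
have -> : val (I1_d * I1_int) p = (op_int K p)^`() by [].
have -> : val (1 : I1 K) p = p by [].
by rewrite coef_deriv coef_poly_int -[LHS]mulr_natr divfK ?natrS_neq0.
Qed.

Lemma I1_eval0 p : val (1 - I1_int * I1_d) p = (p`_0)%:P.
Proof.
have -> : val (1 - I1_int * I1_d) p = p + (-1) *: op_int K p^`() by [].
rewrite scaleN1r; apply/polyP => -[|k];
  rewrite coefB coef_poly_int coefC /= ?subr0 //.
by rewrite coef_deriv -[p`_k.+1 *+ _]mulr_natr mulfK ?subrr ?natrS_neq0.
Qed.

Lemma I1_dX k p : val (I1_d ^+ k) p = p^`(k).
Proof.
by elim: k p => // k IH p; rewrite exprS derivnS -IH.
Qed.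

Lemma I1_intX k : exists2 a, a != 0 &
  forall c, val (I1_int ^+ k) c%:P = (a * c) *: 'X^k.
Proof.
elim: k => [|k [a a0 IH]].
  by exists 1 => [|c]; rewrite ?oner_neq0 // mul1r expr0 alg_polyC.
exists (a / k.+1%:R) => [|c]; first by rewrite mulf_neq0 ?invr_eq0 ?natrS_neq0.
rewrite exprS; have -> : val (I1_int * I1_int ^+ k) c%:P =
  op_int K (val (I1_int ^+ k) c%:P) by [].
by rewrite IH linearZ_LR op_intXn scalerA mulrAC.
Qed.

(** The factor a is j! / m!, which is invertible in characteristic zero. *)
Lemma I1_entry (f : I1 K) j m : exists2 a, a != 0 & forall p,
  val (entry I1_d I1_int f j m) p = (a * p`_0 * (val f 'X^m)`_j)%:P.
Proof.
have [a a0 aE] := I1_intX m.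
exists (a * j`!%:R) => [|p].
  by rewrite mulf_neq0 // -(prednK (fact_gt0 j)) natrS_neq0.
have -> : val (entry I1_d I1_int f j m) p =
  val (1 - I1_int * I1_d) (val (I1_d ^+ j) (val f (val (I1_int ^+ m)
    (val (1 - I1_int * I1_d) p)))) by [].
rewrite !I1_eval0 aE I1_dX linearZ coef_derivn addn0 ffactnn coefZ.
by rewrite mulr_natr !mulrnAl.
Qed.

Lemma I1_shift_pair : shift_pair I1_d I1_int.
Proof.
split=> [|f|f f0]; first exact: I1_d_int.
  have [N fN] := I1_banded f; exists N => j m /fN fjm.
  have [a _ aE] := I1_entry f j m.
  by apply/val_inj/polyEndP => p; rewrite aE fjm mulr0.
apply/val_inj/polyEndP => p; rewrite polyEnd_expand big1 // => m _.
suff -> : val f 'X^m = 0 by rewrite scaler0.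
apply/polyP => j; have [a a0 aE] := I1_entry f j m.
have := aE 1; rewrite f0 coefC eqxx mulr1 => /esym/eqP.
by rewrite polyC_eq0 mulf_eq0 (negPf a0) coef0 => /eqP.
Qed.

End IntegroDifferential.

Lemma integrodiff_shift_pair (K : fieldType) (n : nat) (A : algType K) :
  [pchar K] =i pred0 -> (0 < n)%N ->
  exists D J : tens (integrodiff K n) A, shift_pair D J.
Proof.
move=> charK n_gt0.
suff [D [J DJ]] : exists D J : integrodiff K n, shift_pair D J.
  by exists (pure D 1), (pure J 1); apply: shift_pair_tens.
have I1P := I1_shift_pair charK.
case: n n_gt0 => [//|[|n]] _; first by exists (I1_d K), (I1_int K).
by exists (pure (I1_d K) 1), (pure (I1_int K) 1); apply: shift_pair_tens.
Qed.

Theorem lemma4p8 (K : fieldType) (charK : [pchar K] =i pred0)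
    (n : nat) (n_gt0 : (0 < n)%N) (A : algType K) :
  [/\ ~ left_ore_set (regular_elements (tens (integrodiff K n) A)),
      ~ right_ore_set (regular_elements (tens (integrodiff K n) A)),
      ~ (exists (Q : pzRingType) (i : {rmorphism tens (integrodiff K n) A -> Q}),
           is_left_quotient_ring
             (regular_elements (tens (integrodiff K n) A)) i)
    & ~ (exists (Q : pzRingType) (i : {rmorphism tens (integrodiff K n) A -> Q}),
           is_right_quotient_ring
             (regular_elements (tens (integrodiff K n) A)) i)]
  /\
  [/\ forall (Q : pzRingType) (i : {rmorphism tens (integrodiff K n) A -> Q}),
        is_left_quotient_ring (left_ore_max (tens (integrodiff K n) A)) i ->
        has_infinite_direct_sum_of_left_ideals Q /\ ~ left_noetherian Q
    & forall (Q : pzRingType) (i : {rmorphism tens (integrodiff K n) A -> Q}),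
        is_right_quotient_ring (right_ore_max (tens (integrodiff K n) A)) i ->
        has_infinite_direct_sum_of_right_ideals Q /\ ~ right_noetherian Q].
Proof.
have [D [J DJ]] := integrodiff_shift_pair A charK n_gt0.
have JD := shift_pair_converse DJ.
have nl := regular_not_left_ore DJ; have nr := regular_not_left_ore JD.
split; split.
- exact: nl.
- by move=> /right_ore_converse; rewrite -regular_converse.
- by case=> Q [i /left_quotient_ring_regular_ore].
- case=> Q [i /right_quotient_ring_converse[j]]; rewrite -regular_converse.
  by move/left_quotient_ring_regular_ore.
- move=> Q i /(shift_pair_left_quotient DJ) sumQ; split=> //.
  exact: infinite_direct_sum_not_noetherian.
- move=> Q i /right_quotient_ring_converse[j]; rewrite right_ore_max_converse.
  move=> /(shift_pair_left_quotient JD) sumQ; split; first exact: sumQ.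
  exact: (infinite_direct_sum_not_noetherian sumQ).
Qed.
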